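(* Let $X,\mu,G=(\mathcal N,\mathcal A),\mathcal S,c,(c_{ij}),(s_i),(a_{ij}),(b_{ij})$ be data as in the context, and assume: (1a) $c: X\times\mathcal S\to\mathbb R\cup\{+\infty\}$ is lower semi-continuous and bounded from below; (1b) $X$ is compact; (1c) for every $(i,j)\in\mathcal A$, $c_{ij}:\mathbb R\to\mathbb R\cup\{+\infty\}$ is convex and lower semi-continuous; (1d) the problem (M) described in the context admits a feasible solution; (2) for every pair of distinct $i,j\in\mathcal S$ and every $r\in\mathbb R$, the set $\{x\in X: c(x,i)-c(x,j)=r\}$ has $\mu$-measure zero; (3) there exists a maximizer over $\mathbb R^{|\mathcal N|}$ of the dual function $q$ defined in the context; (4) for every $(i,j)\in\mathcal A$, $c_{ij}$ is strictly convex. Let $\psi^*\in\mathbb R^{|\mathcal N|}$ be a maximizer of $q$. For each $(i,j)\in\mathcal A$ let $$p^*_{ij}:=\arg\min_{p\in[a_{ij},b_{ij}]}\{c_{ij}(p)-(\psi^*_i-\psi^*_j)p\}$$ (the unique minimizer), and let $p^*=(p^*_{ij})_{(i,j)\in\mathcal A}\in\mathbb R^{|\mathcal A|}$. Define $T^*:X\to\mathcal S$ by $$T^*(x):=\arg\min_{i\in\mathcal S}\{c(x,i)-\psi^*_i\}\qquad\text{for every }x\in X,$$ with ties between endpoints in the minimization broken arbitrarily, if any. Then the pair $(T^*,p^* )$ is an optimal solution of (M).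
   Context: Setting. $X$ is a (Hausdorff) topological space equipped with a non-negative Radon measure $\mu$. ''$\mu$-measurable'' means measurable with respect to the $\mu$-completion of the Borel $\sigma$-algebra. $G=(\mathcal N,\mathcal A)$ is a directed graph with finite node set $\mathcal N\subset\mathbb N$ and arc set $\mathcal A\subset\mathcal N\times\mathcal N$. Each node $i\in\mathcal N$ has a net supply $s_i\in\mathbb R$ (of any sign). $\mathcal S\subset\mathcal N$ is a subset of nodes (the endpoints), with the discrete topology. $c:X\times\mathcal S\to\mathbb R\cup\{+\infty\}$ is the assignment cost, $c_{ij}:\mathbb R\to\mathbb R\cup\{+\infty\}$, $(i,j)\in\mathcal A$, are arc costs, and $a_{ij},b_{ij}\in\mathbb R$ are lower and upper arc flow limits. Strict convexity of an extended-valued function is understood on the set where it is finite. In hypothesis (2), $c(x,i)-c(x,j)=r$ with $r\in\mathbb R$ requires both costs to be finite. Problem (M): minimize $$\int_X c(x,T(x))\,\mathrm d\mu(x)+\sum_{(i,j)\in\mathcal A}c_{ij}(p_{ij})$$ over $\mu$-measurable maps $T:X\to\mathcal S$ and vectors $p=(p_{ij})_{(i,j)\in\mathcal A}\in\mathbb R^{|\mathcal A|}$ subject to $$\sum_{j:(i,j)\in\mathcal A}p_{ij}-\sum_{j:(j,i)\in\mathcal A}p_{ji}=s_i-\mu(T^{-1}(i))\quad\forall i\in\mathcal S,$$ $$\sum_{j:(i,j)\in\mathcal A}p_{ij}-\sum_{j:(j,i)\in\mathcal A}p_{ji}=s_i\quad\forall i\in\mathcal N\setminus\mathcal S,$$ $$a_{ij}\le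 p_{ij}\le b_{ij}\quad\forall(i,j)\in\mathcal A.$$ A feasible solution of (M) is a pair $(T,p)$ satisfying these constraints with finite objective value. (Existence of one implies $\mu(X)=\sum_{i\in\mathcal N}s_i<\infty$.) Dual function: $q:\mathbb R^{|\mathcal N|}\to\mathbb R$, $$q(\psi)=\int_X \min_{i\in\mathcal S}\{c(x,i)-\psi_i\}\,\mathrm d\mu(x)+\sum_{i\in\mathcal N}\psi_i s_i+\sum_{(i,j)\in\mathcal A}\ \min_{p\in[a_{ij},b_{ij}]}\{c_{ij}(p)-(\psi_i-\psi_j)p\}.$$ *)

(* Defs.v *)
From HB Require Import structures.
From mathcomp Require Import all_boot all_order all_algebra.
From mathcomp Require Import all_classical all_reals all_analysis.
From mathcomp Require Import measurable_realfun.

Set Implicit Arguments.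
Unset Strict Implicit.
Unset Printing Implicit Defensive.

Import Order.TTheory GRing.Theory Num.Theory.
Import numFieldNormedType.Exports.

Local Open Scope classical_set_scope.
Local Open Scope ring_scope.

Definition borel (X : ptopologicalType) := g_sigma_algebraType (@open X).

(* On a Hausdorff space compact sets are closed, so [mu K] below is the measure
   of a Borel set. *)
Definition radon (R : realType) (X : ptopologicalType)
    (mu : {measure set (borel X) -> \bar R}) : Prop :=
  (forall x : X, exists U : set X, [/\ open U, U x & (mu U < +oo)%E]) /\
  (forall A : set (borel X), measurable A ->
    mu A = ereal_sup [set mu K | K in [set K : set X | compact K /\ K `<=` A]]).

Section completion.
Context d (T : measurableType d) (R : realType).
Variable mu : {measure set T -> \bar R}.

(* [completed_algebra_gen mu] consists of the sets A `|` N with A measurable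
   and N contained in a measurable set of measure 0. *)
Definition completed := g_sigma_algebraType (completed_algebra_gen mu).

(* The outer measure gives A `|` N the value mu A, see [completionU]. *)
Definition completion : set completed -> \bar R := (mu^*)%mu.

Lemma mu_ext_negligible (N : set T) :
  mu.-negligible N -> (mu^*)%mu N = 0%E.
Proof.
move=> [B [mB B0 NB]]; apply/eqP; rewrite eq_le outer_measure_ge0 andbT.
by rewrite -B0 -(measurable_mu_extE mu mB); exact: le_outer_measure.
Qed.

Lemma completed_caratheodory :
  (measurable : set (set completed)) `<=` ((mu^*)%mu).-cara.-measurable.
Proof.
apply: smallest_sub.
  split; first exact: measurable0.
  - by move=> A mA; rewrite setTD; exact: measurableC.
  - by move=> F mF; exact: bigcupT_measurable.
move=> _ [A mA [N nN <-]]; apply: measurableU.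
  exact: caratheodory_measurable_mu_ext.
apply: le_caratheodory_measurable => Y.
have YN0 : (mu^*)%mu (Y `&` N) = 0%E.
  apply: mu_ext_negligible; apply: negligibleS nN; exact: subIsetr.
rewrite [X in (X + _)%E]YN0 add0e; apply: le_outer_measure; exact: subIsetl.
Qed.

Let completion0 : completion set0 = 0%E.
Proof. exact: outer_measure0. Qed.

Let completion_ge0 (A : set completed) : (0 <= completion A)%E.
Proof. exact: outer_measure_ge0. Qed.

Let completion_sigma_additive : semi_sigma_additive completion.
Proof.
move=> F mF tF mUF; apply: caratheodory_measure_sigma_additive => //.
- by move=> i; exact: completed_caratheodory.
- exact: completed_caratheodory.
Qed.

HB.instance Definition _ := isMeasure.Build _ _ _ completion
  completion0 completion_ge0 completion_sigma_additive.

Lemma completionU (A N : set T) :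
  measurable A -> mu.-negligible N -> completion (A `|` N) = mu A.
Proof.
move=> mA nN; rewrite -(measurable_mu_extE mu mA).
apply/eqP; rewrite eq_le; apply/andP; split; last first.
  by apply: le_outer_measure; exact: subsetUl.
rewrite -[leRHS]adde0 -(mu_ext_negligible nN); exact: outer_measureU2.
Qed.

End completion.
Arguments completion {d T R} mu _.

Section extended_functions.
Context (R : realType).
Implicit Types (f : R -> \bar R).
Local Open Scope ereal_scope.

(* Both notions are meant for functions that avoid -oo; recall 0 * +oo = 0. *)
Definition convex_ereal f : Prop := forall (x y t : R),
  (0 <= t <= 1)%R ->
  f (t * x + (1 - t) * y)%R <= t%:E * f x + (1 - t)%:E * f y.

Definition strictly_convex_ereal f : Prop := forall (x y t : R),
  x != y -> f x \is a fin_num -> f y \is a fin_num -> (0 < t < 1)%R ->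
  f (t * x + (1 - t) * y)%R < t%:E * f x + (1 - t)%:E * f y.

Definition argmin_on (U : Type) (D : set U) (h : U -> \bar R) (u : U) : Prop :=
  D u /\ forall v, D v -> h u <= h v.

Definition is_maximizer (U : Type) (h : U -> \bar R) (u : U) : Prop :=
  forall v, h v <= h u.

End extended_functions.

Definition network_arc (V : finType) (A : {set V * V}) : Type :=
  {e : V * V | e \in A}.
HB.instance Definition _ (V : finType) (A : {set V * V}) :=
  Finite.copy (network_arc A) {e : V * V | e \in A}.

Definition arc_tail (V : finType) (A : {set V * V}) (e : network_arc A) : V :=
  (val e).1.
Definition arc_head (V : finType) (A : {set V * V}) (e : network_arc A) : V :=
  (val e).2.

Definition endpoint (V : finType) (S : {set V}) : Type :=
  discrete_topology {i : V | i \in S}.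
HB.instance Definition _ (V : finType) (S : {set V}) :=
  Finite.copy (endpoint S) {i : V | i \in S}.
HB.instance Definition _ (V : finType) (S : {set V}) :=
  DiscreteTopology.copy (endpoint S) (discrete_topology {i : V | i \in S}).

Definition endpoint_node (V : finType) (S : {set V}) (i : endpoint S) : V :=
  sval i.

Section problem.
Context (R : realType) (X : ptopologicalType).
Variable mu : {measure set (borel X) -> \bar R}.
Context (V : finType) (A : {set V * V}) (S : {set V}).
Variables (s : V -> R) (c : X * endpoint S -> \bar R).
Variables (ca : network_arc A -> R -> \bar R) (a b : network_arc A -> R).
Local Open Scope ereal_scope.

(* Every subset of [endpoint S] is open, hence Borel. *)
Definition mu_measurable (T : X -> endpoint S) : Prop :=
  forall B : set (endpoint S), measurable (T @^-1` B : set (completed mu)).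

Definition net_outflow (p : network_arc A -> R) (i : V) : R :=
  (\sum_(e : network_arc A | arc_tail e == i) p e -
   \sum_(e : network_arc A | arc_head e == i) p e)%R.

Definition admissible (T : X -> endpoint S) (p : network_arc A -> R) : Prop :=
  [/\ mu_measurable T,
      forall i : endpoint S, (net_outflow p (endpoint_node i))%:E =
        (s (endpoint_node i))%:E - completion mu (T @^-1` [set i]),
      forall i : V, i \notin S -> net_outflow p i = s i
    & forall e : network_arc A, (a e <= p e <= b e)%R].

Definition objective (T : X -> endpoint S) (p : network_arc A -> R) : \bar R :=
  \int[completion mu]_x c (x, T x) + \sum_(e : network_arc A) ca e (p e).

Definition feasible (T : X -> endpoint S) (p : network_arc A -> R) : Prop :=
  admissible T p /\ objective T p \is a fin_num.

Definition optimal (T : X -> endpoint S) (p : network_arc A -> R) : Prop :=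
  feasible T p /\
  forall T' p', admissible T' p' -> objective T p <= objective T' p'.

Definition reduced_assignment_cost (psi : V -> R) (x : X) (i : endpoint S) :
  \bar R := c (x, i) - (psi (endpoint_node i))%:E.

Definition reduced_arc_cost (psi : V -> R) (e : network_arc A) (t : R) : \bar R :=
  ca e t - ((psi (arc_tail e) - psi (arc_head e)) * t)%:E.

(* Over the compact [a e, b e] the infimum of a lower semicontinuous function is
   a minimum. As soon as the primal problem is feasible, every term is finite
   and [dual] is real-valued. *)
Definition dual (psi : V -> R) : \bar R :=
  \int[completion mu]_x
    (\big[Order.min/+oo]_(i : endpoint S) reduced_assignment_cost psi x i)
  + (\sum_(i : V) psi i * s i)%:E
  + \sum_(e : network_arc A)
      ereal_inf [set reduced_arc_cost psi e t | t in `[a e, b e]].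

End problem.

(* Main.v *)
Require Import Defs.
From HB Require Import structures.
From mathcomp Require Import all_boot all_order all_algebra finmap.
From mathcomp Require Import all_classical all_reals all_analysis.
From mathcomp Require Import measurable_realfun ring lra.

Set Implicit Arguments.
Unset Strict Implicit.
Unset Printing Implicit Defensive.

Import Order.TTheory GRing.Theory Num.Theory.
Import numFieldNormedType.Exports.

Local Open Scope classical_set_scope.
Local Open Scope ring_scope.

(** For every price vector [psi] and every admissible [(T, p)], the dual value is
    at most the Lagrangian of [(T, p)], which by flow conservation equals the
    objective; when [T] and [p] minimize the reduced costs, the dual value equals
    their Lagrangian. For such [T] and [p], optimality therefore reduces to
    admissibility, which is the first-order condition for the maximizer [psi].
    Changing the price of a single node [k] by [t = 1/(n+1)] or [t = -1/(n+1)]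
    changes the dual function by at least
    [t * (s k - w n - outflow of the perturbed arc minimizers at k)], where [w n] is
    the measure of a set which increases or decreases to the cell assigned to [k]
    up to ties, a null set by hypothesis. By strict convexity and lower
    semicontinuity the perturbed arc minimizers converge to [p], and the two signs
    of [t] give flow conservation at [k]. *)

(** * Lower semicontinuous functions and their minimizers *)

Lemma ereal_lt_dense_fin (R : realType) (x y : \bar R) :
  (x < y)%E -> exists r : R, (x < r%:E)%E /\ (r%:E < y)%E.
Proof.
move: x y => [x| |] [y| |] //=; rewrite ?lte_fin.
- by move=> xy; exists ((x + y) / 2); rewrite !lte_fin; split; lra.
- by move=> _; exists (x + 1); rewrite lte_fin ltry; split => //; lra.
- by move=> _; exists (y - 1); rewrite lte_fin ltNyr; split => //; lra.
- by move=> _; exists 0; rewrite ltNyr ltry.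
Qed.

(** Without a minimizer, the open sets where [f] exceeds a real level, taken over levels above some
    value of [f] on [K], cover [K]. The least level of a finite subcover lies above some [f v] with
    [v] in [K], yet [v] must be covered by a level at least as large. *)
Lemma lsc_argmin_exists (R : realType) (U : ptopologicalType) (f : U -> \bar R)
    (K : set U) :
  lower_semicontinuous f -> compact K -> K !=set0 -> exists u, argmin_on K f u.
Proof.
move=> /lower_semicontinuousP flsc; rewrite compact_cover => cK [u0 Ku0].
apply: contrapT => noargmin.
have below x : K x -> exists2 v, K v & (f v < f x)%E.
  move=> Kx; apply: contrapT => nolt; apply: noargmin; exists x; split=> // v Kv.
  by rewrite leNgt; apply/negP => fvx; apply: nolt; exists v.
pose D := [set r : R | exists2 v, K v & (f v < r%:E)%E].
have [||D' D'D KD'] := cK R D (fun r => [set x | (r%:E < f x)%E]).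
- by move=> r _; exact: flsc.
- move=> x Kx; have [v Kv /ereal_lt_dense_fin] := below _ Kx.
  by move=> [r [fvr rfx]]; exists r => //; exists v.
have [r1 /= r1D' _] := KD' _ Ku0.
have [r0 _ r0_min] := @arg_minP _ _ _ [` r1D']%fset xpredT (val : D' -> R) isT.
have [v Kv fvr0] : D (val r0) by apply/set_mem/D'D/valP.
have [r /= rD' rfv] := KD' _ Kv.
have := r0_min [` rD']%fset isT; rewrite /= leNgt -lte_fin.
by rewrite (lt_trans rfv fvr0).
Qed.

(** A real [q] strictly between [r + g x] and [f x] decouples the two functions: near [x], [f] stays
    above [q] and [r + g] below it. *)
Lemma lscB_continuous (R : realType) (U : topologicalType) (f : U -> \bar R)
    (g : U -> R) :
  lower_semicontinuous f -> continuous g ->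
  lower_semicontinuous (fun x => (f x - (g x)%:E)%E).
Proof.
move=> flsc gcont x r /=; rewrite EFinN lteBrDr// -EFinD => /ereal_lt_dense_fin[q [rgq qf]].
have [V xV Vf] := flsc x q qf.
exists (V `&` [set y | r + g y < q]).
  apply: filterI => //; move: rgq; rewrite lte_fin => rgq.
  have : (fun y => r + g y) @ x --> r + g x by apply: cvgD; [exact: cvg_cst|exact: gcont].
  by move/cvgr_lt; apply.
by move=> y [Vy /= ryq]; rewrite EFinN lteBrDr// -EFinD (lt_trans _ (Vf _ Vy))// lte_fin.
Qed.

Lemma strictly_convexB_linear (R : realType) (f : R -> \bar R) (y : R) :
  strictly_convex_ereal f ->
  strictly_convex_ereal (fun x => (f x - (y * x)%:E)%E).
Proof.
move=> fconv u v t uv; rewrite !fin_numB/= !andbT => fu fv t01.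
have := fconv u v t uv fu fv t01.
move: fu fv; case: (f u) => // fu _; case: (f v) => // fv _.
case: (f _) => [w| |]; rewrite -?(EFinM, EFinD, EFinB, EFinN) ?lte_fin ?ltNyr //; lra.
Qed.

(** The midpoint of two distinct minimizers would have a strictly smaller value. *)
Lemma strictly_convex_argmin_unique (R : realType) (f : R -> \bar R) (l u p q : R) :
  strictly_convex_ereal f -> f p \is a fin_num ->
  argmin_on `[l, u] f p -> argmin_on `[l, u] f q -> q = p.
Proof.
move=> fconv fp [lup minp] [luq minq]; apply/eqP; apply: contraT => qp.
have fpq : f q = f p by apply/eqP; rewrite eq_le minp// minq.
have h01 : 0 < (2^-1 : R) < 1 by lra.
have := fconv q p 2^-1 qp; rewrite fpq => /(_ fp fp h01).
rewrite ltNge => /negP[]; apply: (@le_trans _ _ (f p)).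
  move: fp; case: (f p) => // r _; rewrite -!EFinM -EFinD lee_fin; lra.
apply: minp => /=; move: lup luq; rewrite /= !in_itv/=; lra.
Qed.

(** Away from [p] the minimum of [f] over the compact remainder exceeds [f p] by a positive gap, and
    a linear term with small slope varies too little on the segment to close it. *)
Lemma argmin_perturb_cvg (R : realType) (f : R -> \bar R) (l u p : R)
    (t q : nat -> R) :
  lower_semicontinuous f -> f p \is a fin_num -> argmin_on `[l, u] f p ->
  (forall v, argmin_on `[l, u] f v -> v = p) ->
  t @ \oo --> 0 ->
  (forall n, argmin_on `[l, u] (fun x => (f x - (t n * x)%:E)%E) (q n)) ->
  q @ \oo --> p.
Proof.
move=> flsc fp [lup minp] uniq t0 qmin; apply/cvgrPdist_lt => e e0.
pose K := `[l, u] `&` ~` ball p e.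
have cK : compact K.
  apply: (subclosed_compact _ (@segment_compact _ l u)); last exact: subIsetl.
  apply: closedI; [exact: itv_closed|apply: open_closedC; exact: ball_open].
have [K0|/set0P Kn0] := eqVneq K set0.
  near=> n; have [luq _] := qmin n.
  by apply: contrapT => far; have : K (q n) by []; rewrite K0.
have [w [[luw pw] wmin]] := lsc_argmin_exists flsc cK Kn0.
have fpw : (f p < f w)%E.
  rewrite lt_neqAle minp// andbT; apply/eqP => fpw; apply: pw.
  have -> : w = p by apply: uniq; split=> // v luv; rewrite -fpw minp.
  exact: ballxx.
(* A real intermediate level provides the gap even when [f w] is infinite. *)
have [r [fpr rfw]] := ereal_lt_dense_fin fpw.
have lu : l <= u by move: lup; rewrite /= in_itv/=; lra.
move: fp fpr; case fpE : (f p) => [y| |]// _; rewrite lte_fin => yr.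
(* The [+ 1] keeps the divisor positive when the segment is a single point. *)
have d0 : 0 < (r - y) / (u - l + 1) by rewrite divr_gt0//; lra.
near=> n; have [luq qminn] := qmin n.
apply: contrapT => far; have Kq : K (q n) by [].
have small : `|t n| < (r - y) / (u - l + 1).
  have : `|0 - t n| < (r - y) / (u - l + 1).
    by near: n; move/cvgrPdist_lt : t0; exact.
  by rewrite sub0r normrN.
have := qminn _ lup; have := lt_le_trans rfw (wmin _ Kq); rewrite fpE.
case: (f (q n)) => [v| |]//; rewrite lte_fin => rv; rewrite -!EFinB lee_fin => le1.
have : `|t n * (q n - p)| <= `|t n| * (u - l + 1).
  rewrite normrM ler_wpM2l// ler_norml; move: luq lup; rewrite /= !in_itv/=; lra.
move: small; rewrite ltr_pdivlMr; last lra.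
rewrite ler_norml => ? /andP[]; lra.
Unshelve. all: by end_near. Qed.

(** * Integration over finite and completed measures *)

Section finite_measure_integrals.
Context d (Y : measurableType d) (R : realType).
Variable nu : {measure set Y -> \bar R}.
Hypothesis nu_fin : (nu setT < +oo)%E.
Local Open Scope ereal_scope.

Lemma fin_num_of_finite (A : set Y) : measurable A -> nu A \is a fin_num.
Proof.
move=> mA; rewrite ge0_fin_numE// (le_lt_trans _ nu_fin)//.
by apply: le_measure; rewrite ?inE.
Qed.

Lemma integrable_indic_of_finite (A : set Y) :
  measurable A -> nu.-integrable setT (fun x => (\1_A x)%:E).
Proof.
move=> mA; apply/integrableP; split.
  by apply/measurable_EFinP; exact: measurable_indic.
under eq_integral do rewrite abse_EFin ger0_norm//.
by rewrite integral_indic// setIT -ge0_fin_numE// fin_num_of_finite.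
Qed.

Lemma integrable_cst_of_finite (r : R) : nu.-integrable setT (fun=> r%:E).
Proof.
apply: (eq_integrable _ (fun x => r%:E * (\1_setT x)%:E)) => //.
  by move=> x _; rewrite indicT mule1.
exact/integrableZl/integrable_indic_of_finite.
Qed.

Lemma integrable_between (m : R) (f k : Y -> \bar R) :
  measurable_fun setT f -> (forall x, m%:E <= f x) -> (forall x, f x <= k x) ->
  nu.-integrable setT k -> nu.-integrable setT f.
Proof.
move=> mf mlef flek ik.
apply: (@le_integrable _ _ _ _ _ _ _ (fun x => `|m|%:E + `|k x|)) => //.
  move=> x _; rewrite [leRHS]gee0_abs ?adde_ge0//.
  move: (mlef x) (flek x); case: (f x) => [y| |]//; case: (k x) => [z| |]//=;
    last by rewrite addey ?leey.
  rewrite !lee_fin => my yz; have := ler_norm z; have := ler_norm (- m).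
  have := normr_ge0 m; have := normr_ge0 z; rewrite normrN ler_norml; lra.
exact: (integrableD measurableT (integrable_cst_of_finite `|m|) (integrable_abse ik)).
Qed.

Lemma integral_funeneg_fin_num (m : R) (f : Y -> \bar R) :
  measurable_fun setT f -> (forall x, m%:E <= f x) ->
  \int[nu]_x f^\- x \is a fin_num.
Proof.
move=> mf mlef.
rewrite ge0_fin_numE ?integral_ge0//; apply: (@le_lt_trans _ _ (\int[nu]_x (cst `|m|%:E x))).
  apply: ge0_le_integral => //; first exact: measurable_funeneg.
  move=> x _; rewrite funenegE ge_max lee_fin normr_ge0 andbT leeNl -EFinN.
  by apply: le_trans (mlef x); rewrite lee_fin lerNl -normrN ler_norm.
by rewrite integral_cst// lte_mul_pinfty.
Qed.

Lemma integral_gtNy_of_bounded_below (m : R) (f : Y -> \bar R) :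
  measurable_fun setT f -> (forall x, m%:E <= f x) -> -oo < \int[nu]_x f x.
Proof.
move=> mf mlef; have := integral_funeneg_fin_num mf mlef=> fneg.
rewrite integralE lteBrDr// (@lt_le_trans _ _ 0)//; last exact: integral_ge0.
by rewrite -(fineK fneg) ltNyr.
Qed.

(** On a finite measure space the lower bound makes the negative part integrable, so an integral
    below [+oo] forces the positive part to be integrable too. *)
Lemma integrable_of_bounded_below (m : R) (f : Y -> \bar R) :
  measurable_fun setT f -> (forall x, m%:E <= f x) -> \int[nu]_x f x < +oo ->
  nu.-integrable setT f.
Proof.
move=> mf mlef; have fneg := integral_funeneg_fin_num mf mlef.
rewrite integralE lteBlDr// => lty.
apply/integrableP; split=> //.
have -> : (fun x => `|f x|) = (f^\+ \+ f^\-) by exact: fune_abse.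
rewrite ge0_integralD//; [|exact: measurable_funepos|exact: measurable_funeneg].
by rewrite lte_add_pinfty// ?(lt_le_trans lty) ?leey// -ge0_fin_numE ?integral_ge0.
Qed.

Section finite_image.
Context (I : finType) (T : Y -> I).
Hypothesis mT : forall i, measurable (T @^-1` [set i]).

Lemma comp_finite_indic (h : I -> R) (x : Y) :
  (h (T x))%:E = \sum_i (h i)%:E * (\1_(T @^-1` [set i]) x)%:E.
Proof.
rewrite (bigD1 (T x))//= big1 ?adde0; last first.
  by move=> i /eqP iT; rewrite indicE memNset ?mule0//= => /esym.
by rewrite indicE mem_set ?mule1.
Qed.

Lemma integrable_comp_finite (h : I -> R) :
  nu.-integrable setT (fun x => (h (T x))%:E).
Proof.
under [X in nu.-integrable _ X]eq_fun do rewrite comp_finite_indic.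
apply: integrable_sum => // i _.
exact/integrableZl/integrable_indic_of_finite.
Qed.

Lemma integral_comp_finite (h : I -> R) :
  \int[nu]_x (h (T x))%:E = \sum_i (h i)%:E * nu (T @^-1` [set i]).
Proof.
under eq_integral do rewrite comp_finite_indic.
rewrite integral_sum//; last first.
  by move=> i; exact/integrableZl/integrable_indic_of_finite.
apply: eq_bigr => i _.
by rewrite integralZl ?integral_indic ?setIT//; exact: integrable_indic_of_finite.
Qed.

End finite_image.
End finite_measure_integrals.
Section completion_facts.
Context d (Y : measurableType d) (R : realType).
Variable mu : {measure set Y -> \bar R}.
Local Open Scope ereal_scope.

Lemma measurable_completed (A : set Y) :
  measurable A -> measurable (A : set (completed mu)).
Proof.
move=> mA; apply: sub_sigma_algebra; exists A => //; exists set0 => /=.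
  exact: negligible_set0.
by rewrite setU0.
Qed.

Lemma completionE (A : set Y) : measurable A -> completion mu A = mu A.
Proof.
by move=> mA; rewrite -[A in LHS]setU0 completionU//; exact: negligible_set0.
Qed.

Lemma measurable_fun_completed (f : Y -> \bar R) :
  measurable_fun setT f -> measurable_fun setT (f : completed mu -> \bar R).
Proof. by move=> mf _ B mB; apply: measurable_completed; exact: mf. Qed.

(** [A] differs from [B] by a subset of the null set [E \ B]. This serves for fibers of maps with
    arbitrary tie-breaking, which are only known up to such a gap. *)
Lemma measurable_completed_between (B A E : set Y) :
  measurable B -> measurable E -> B `<=` A -> A `<=` E -> mu (E `\` B) = 0 ->
  measurable (A : set (completed mu)) /\ completion mu A = mu B.
Proof.
move=> mB mE BA AE EB0.
have nAB : mu.-negligible (A `\` B).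
  exists (E `\` B); split=> //; [exact: measurableD|exact: setSD].
have <- : B `|` (A `\` B) = A by rewrite setDUK.
split; last exact: completionU.
by apply: sub_sigma_algebra; exists B => //; exists (A `\` B).
Qed.

End completion_facts.

(** * Minimal assignment cost and its dependence on one price *)

Section min_cost.
Context (Y : Type) (R : realType) (I : finType).
Local Open Scope ereal_scope.

Definition min_cost (g : Y -> I -> \bar R) (h : I -> R) (x : Y) : \bar R :=
  \big[Order.min/+oo]_i (g x i - (h i)%:E).

(** The index type is arbitrary because both node prices and endpoint prices are perturbed; a
    negative [t] lowers the price. *)
Definition raise_price (h : I -> R) (k : I) (t : R) (i : I) : R :=
  (h i + t * (i == k)%:R)%R.

(* For [t > 0] these cells bracket the set of points assigned to [k]: raising the
   price of [k] by [t] lowers the minimal cost on the upper cell only, by at most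
   [t]; lowering it by [t] raises the minimal cost by at least [t] on the lower
   cell. *)
Definition upper_cell (g : Y -> I -> \bar R) (h : I -> R) (k : I) (t : R) : set Y :=
  [set x | g x k - (h k)%:E <= min_cost g h x + t%:E].

Definition lower_cell (g : Y -> I -> \bar R) (h : I -> R) (k : I) (t : R) : set Y :=
  [set x | g x k - (h k)%:E + t%:E <=
           \big[Order.min/+oo]_(i | i != k) (g x i - (h i)%:E)].

Variables (g : Y -> I -> \bar R) (h : I -> R).

Lemma min_cost_le (x : Y) (i : I) : min_cost g h x <= g x i - (h i)%:E.
Proof. exact: bigmin_le. Qed.

Lemma min_cost_argmin (x : Y) (i : I) :
  argmin_on [set: I] (fun i => g x i - (h i)%:E) i ->
  min_cost g h x = g x i - (h i)%:E.
Proof.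
move=> [_ imin]; apply/eqP; rewrite eq_le min_cost_le/=.
by apply: le_bigmin => [|j _]; [exact: leey|exact: imin].
Qed.

Lemma min_cost_bounded_below (m : R) : (forall x i, m%:E <= g x i) ->
  exists m', forall x, m'%:E <= min_cost g h x.
Proof.
move=> mg; exists (m - \sum_i `|h i|)%R => x.
apply: le_bigmin => [|i _]; first exact: leey.
rewrite leeBrDr// (le_trans _ (mg x i))// -EFinD lee_fin.
have : (h i <= \sum_i `|h i|)%R.
  rewrite (bigD1 i)//= (le_trans (ler_norm _))// lerDl sumr_ge0//.
lra.
Qed.

(** Only the term of [k] moves, down by [t]. Outside the upper cell it was more than [t] above the
    minimum, so it cannot drop below it. *)
Lemma min_cost_raise_price_ge (k : I) (t : R) (x : Y) : (0 <= t)%R ->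
  min_cost g h x - (t * \1_(upper_cell g h k t) x)%:E <=
  min_cost g (raise_price h k t) x.
Proof.
move=> t0; apply: le_bigmin => [|i _]; first exact: leey.
have [->|ik] := eqVneq i k; last first.
  rewrite /raise_price (negbTE ik) mulr0 addr0; apply: le_trans (min_cost_le x i).
  by rewrite leeBlDr// leeDl// lee_fin mulr_ge0.
rewrite /raise_price eqxx mulr1 EFinD fin_num_oppeD// addeA indicE.
have [xU|/negP xU] := boolP (x \in upper_cell g h k t).
  by rewrite mulr1 leeB// ?min_cost_le.
rewrite mulr0 sube0 leeBrDr// ltW// ltNge; apply/negP => xU'; apply: xU.
exact: mem_set.
Qed.

(** Only the term of [k] moves, up by [t]. On the lower cell every other term already exceeds the
    old term of [k] by at least [t]. *)
Lemma min_cost_lower_price_ge (k : I) (t : R) (x : Y) : (0 <= t)%R ->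
  min_cost g h x + (t * \1_(lower_cell g h k t) x)%:E <=
  min_cost g (raise_price h k (- t)) x.
Proof.
move=> t0; apply: le_bigmin => [|i _]; first exact: leey.
have [->|ik] := eqVneq i k.
  rewrite /raise_price eqxx mulr1 EFinD fin_num_oppeD// addeA EFinN oppeK.
  apply: leeD; first exact: min_cost_le.
  by rewrite lee_fin ler_piMr// indicE; case: (_ \in _).
rewrite /raise_price (negbTE ik) mulr0 addr0 indicE.
have [/set_mem xL|_] := boolP (x \in lower_cell g h k t); last first.
  by rewrite mulr0 adde0 min_cost_le.
rewrite mulr1 (le_trans (leeD2r _ (min_cost_le x k)))//.
by rewrite (le_trans xL)// bigmin_le_cond.
Qed.

End min_cost.

(** * Measurability and limits of the cells *)

Lemma ereal_le_harmonic (R : realType) (x y : \bar R) :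
  (forall n, x <= y + (n.+1%:R^-1)%:E)%E -> (x <= y)%E.
Proof.
move=> xy; apply/lee_addgt0Pr => _ /posnumP[e].
have [n _ /(_ n (leqnn n)) ne] := near_infty_natSinv_lt e.
by rewrite (le_trans (xy n))// leeD2l// lee_fin ltW.
Qed.

Section measurable_cells.
Context d (Y : measurableType d) (R : realType) (I : finType).
Variables (g : Y -> I -> \bar R) (h : I -> R).
Hypothesis mg : forall i, measurable_fun setT (g^~ i).
Local Open Scope ereal_scope.

Lemma measurable_bigmin (r : seq I) (P : pred I) :
  measurable_fun setT (fun x => \big[Order.min/+oo]_(i <- r | P i) (g x i - (h i)%:E)).
Proof.
elim: r => [|i r IH]; first by under eq_fun do rewrite big_nil; exact: measurable_cst.
under eq_fun do rewrite big_cons; case: (P i) => //.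
by apply: measurable_mine => //; apply: emeasurable_funB.
Qed.

Lemma measurable_min_cost : measurable_fun setT (min_cost g h).
Proof. exact: measurable_bigmin. Qed.

Lemma measurable_upper_cell (k : I) (t : R) : measurable (upper_cell g h k t).
Proof.
rewrite -[upper_cell _ _ _ _]setTI; apply: measurable_lee => //.
  exact: emeasurable_funB.
by apply: emeasurable_funD => //; exact: measurable_min_cost.
Qed.

Lemma measurable_lower_cell (k : I) (t : R) : measurable (lower_cell g h k t).
Proof.
rewrite -[lower_cell _ _ _ _]setTI; apply: measurable_lee => //.
  by apply: emeasurable_funD => //; exact: emeasurable_funB.
exact: measurable_bigmin.
Qed.

Lemma measurable_tie (i j : I) (r : R) :
  measurable [set x | [/\ g x i \is a fin_num, g x j \is a fin_num &
    g x i - g x j = r%:E]].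
Proof.
rewrite (_ : mkset _ = (setT `&` [set x | g x i \is a fin_num]) `&`
    (setT `&` [set x | g x j \is a fin_num]) `&`
    (setT `&` [set x | g x i - g x j = r%:E])).
  apply: measurableI; first by apply: measurableI; exact: emeasurable_fin_num.
  by apply: measurable_eqe => //; exact: emeasurable_funB.
by rewrite !setTI; apply/seteqP; split=> [x [? ? ?]|x [[? ?] ?]].
Qed.

End measurable_cells.

Section cells_limit.
Context d (Y : measurableType d) (R : realType) (I : finType).
Variables (mu : {measure set Y -> \bar R}) (g : Y -> I -> \bar R) (h : I -> R).
Variables (m : R) (T : Y -> I) (k : I).
Local Open Scope ereal_scope.
Hypotheses (nu_fin : completion mu setT < +oo)
  (mg : forall i, measurable_fun setT (g^~ i))
  (mleg : forall x i, m%:E <= g x i)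
  (ties0 : forall i j r, i != j -> completion mu [set x |
     [/\ g x i \is a fin_num, g x j \is a fin_num & g x i - g x j = r%:E]] = 0)
  (int_min : forall h',
    (completion mu).-integrable setT (min_cost g h' : completed mu -> _))
  (Tmin : forall x, argmin_on [set: I] (fun i => g x i - (h i)%:E) (T x)).

Let nu : {measure set (completed mu) -> \bar R} := completion mu.
(** [E] consists of the points where [k] attains the minimal cost. At finite minimal cost, [F]
    consists of those where [k] beats every other index strictly. *)
Let E := \bigcap_n upper_cell g h k n.+1%:R^-1.
Let F := \bigcup_n lower_cell g h k n.+1%:R^-1.
(** Where the minimal cost is [+oo], the inequality defining a lower cell holds as [+oo <= +oo]
    although [T] may select another index; [B] discards these points. *)
Let B := F `&` [set x | min_cost g h x \is a fin_num].

Let mE : measurable E.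
Proof. by apply: bigcapT_measurable => n; exact: measurable_upper_cell. Qed.

Let mF : measurable F.
Proof. by apply: bigcupT_measurable => n; exact: measurable_lower_cell. Qed.

Let mB : measurable B.
Proof.
apply: measurableI => //; rewrite -[mkset _]setTI.
by apply: emeasurable_fin_num => //; exact: measurable_min_cost.
Qed.

Let Tmin_cost x : min_cost g h x = g x (T x) - (h (T x))%:E.
Proof. exact: min_cost_argmin. Qed.

Lemma fiber_sub_upper_cells : T @^-1` [set k] `<=` E.
Proof.
by move=> x /= Txk n _; rewrite /upper_cell /= Tmin_cost Txk leeDl.
Qed.

(** If [T x] were another index, the minimal cost, attained at [T x], would exceed the cost of [k]
    by a positive amount. *)
Lemma lower_cells_sub_fiber : B `<=` T @^-1` [set k].
Proof.
move=> x [[n _ xF] /= minfin]; apply/eqP; apply: contraT => Tk.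
have := le_trans xF (@bigmin_le_cond _ _ _ +oo (T x) (fun i => i != k)
  (fun i => g x i - (h i)%:E) Tk).
rewrite -Tmin_cost => le1; have := min_cost_le g h x k.
move: minfin le1; case: (min_cost _ _ _) => // r _.
case: (g x k) => // v; rewrite -!EFinB -!EFinD !lee_fin.
have : (0 < (n.+1%:R^-1 : R))%R by rewrite invr_gt0.
move: (n.+1%:R^-1)%R => t t0 vt rv. by have : False by lra.
Qed.

(* Where the minimal cost is finite, a point of [E] outside [F] is a tie between [k]
   and some [j], at the difference [h k - h j]. *)
Lemma cells_gap_negligible :
  (completion mu).-negligible (E `\` B : set (completed mu)).
Proof.
pose tie j := [set x : completed mu |
  [/\ g x k \is a fin_num, g x j \is a fin_num & g x k - g x j = (h k - h j)%:E]].
have tie_ae : {ae completion mu, forall x, forall j, j != k -> ~ tie j x}.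
  apply: filter_forall => j; have [->|jk] := eqVneq j k; first exact: nearW.
  exists (tie j); split.
  - by apply: measurable_completed; exact: measurable_tie.
  - by rewrite ties0// eq_sym.
  - by move=> x /= /not_implyP[_ /contrapT].
have : {ae completion mu, forall x, (forall j, j != k -> ~ tie j x) /\
    min_cost g h x \is a fin_num}.
  apply: filterI tie_ae _.
  by apply: filterS (integrable_ae measurableT (int_min h)) => x; apply.
case=> N [mN N0 subN]; exists N; split=> //.
apply: subset_trans subN => x [xE nxB] /= [notie minfin]; apply: nxB; split=> //.
have kmin : g x k - (h k)%:E <= min_cost g h x.
  by apply: ereal_le_harmonic => n; exact: xE.
have gkfin : g x k \is a fin_num.
  move: kmin minfin (mleg x k); case: (min_cost _ _ _) => // r.
  by case: (g x k).
set b := \big[Order.min/+oo]_(i | i != k) (g x i - (h i)%:E).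
have : g x k - (h k)%:E < b.
  apply: lt_bigmin => [|j jk]; first by move: gkfin; case: (g x k) => // r _; rewrite ltry.
  rewrite lt_neqAle (le_trans kmin (min_cost_le g h x j)) andbT.
  apply/eqP => eqkj; apply: (notie j jk); rewrite /tie /=.
  move: gkfin eqkj; case: (g x k) => // r _; case: (g x j) => // s [eqrs].
  by split=> //=; congr EFin; lra.
rewrite ltNge => /negP; apply: contra_notP => xF; apply: ereal_le_harmonic => n.
rewrite leNgt; apply/negP => lt1; apply: xF; exists n => //.
exact: ltW.
Qed.

(** [T] is not assumed measurable. Its fiber lies between the measurable sets [B] and [E], whose
    difference is null, and so does [F]. *)
Lemma measure_fiber : [/\ measurable (T @^-1` [set k] : set (completed mu)),
  completion mu (T @^-1` [set k]) = mu E & completion mu (T @^-1` [set k]) = mu F].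
Proof.
have EB0 : mu (E `\` B) = 0.
  rewrite -completionE; last exact: measurableD.
  apply: measure_negligible cells_gap_negligible.
  by apply: measurable_completed; exact: measurableD.
have BF : B `<=` F by exact: subIsetl.
have FE : F `<=` E.
  move=> x [n _ xF] q _; rewrite /upper_cell /=.
  apply: (@le_trans _ _ (min_cost g h x)); last by rewrite leeDl// lee_fin invr_ge0.
  apply: le_bigmin => [|i _]; first exact: leey.
  have [->//|ik] := eqVneq i k.
  apply: (@le_trans _ _ (g x k - (h k)%:E + n.+1%:R^-1%:E)).
    by rewrite leeDl// lee_fin invr_ge0.
  by apply: (le_trans xF); exact: bigmin_le_cond.
have muEB : mu E = mu B.
  rewrite -(setDUK (subset_trans BF FE)) measureU//; last by rewrite setDIK.
    by rewrite [X in _ + X]EB0 adde0.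
  exact: measurableD.
have muFB : mu F = mu B.
  apply/eqP; rewrite eq_le -{1}muEB !le_measure ?inE//.
have [mT ->] := measurable_completed_between mB mE lower_cells_sub_fiber
  fiber_sub_upper_cells EB0.
by split.
Qed.

Let fin A : measurable A -> mu A \is a fin_num.
Proof.
move=> mA; rewrite -(completionE mu mA).
exact: (@fin_num_of_finite _ _ _ nu nu_fin _ (measurable_completed mA)).
Qed.

Lemma upper_cells_cvg :
  (fun n => fine (mu (upper_cell g h k n.+1%:R^-1))) @ \oo --> fine (mu E).
Proof.
apply: fine_cvg; rewrite fineK ?fin//; apply: nonincreasing_cvg_mu => //.
- by rewrite -ge0_fin_numE// fin//; exact: measurable_upper_cell.
- by move=> n; exact: measurable_upper_cell.
- move=> n q nq; apply/subsetPset => x /le_trans; apply.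
  by rewrite leeD2l// lee_fin lef_pV2 ?posrE// ler_nat.
Qed.

Lemma lower_cells_cvg :
  (fun n => fine (mu (lower_cell g h k n.+1%:R^-1))) @ \oo --> fine (mu F).
Proof.
apply: fine_cvg; rewrite fineK ?fin//; apply: nondecreasing_cvg_mu => //.
- by move=> n; exact: measurable_lower_cell.
- move=> n q nq; apply/subsetPset => x; apply: le_trans.
  by rewrite leeD2l// lee_fin lef_pV2 ?posrE// ler_nat.
Qed.

(** Integrate the pointwise bounds for a raised or lowered price. Here [w n] is the measure of the
    upper cell for [sg = 1] and of the lower cell for [sg = -1]; both tend to the measure of the
    fiber. *)
Lemma integral_min_cost_raise_price (sg : R) : sg = 1%R \/ sg = (-1)%R ->
  exists2 w : nat -> R, w @ \oo --> fine (completion mu (T @^-1` [set k])) &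
  forall n, \int[completion mu]_x min_cost g h x - (sg / n.+1%:R * w n)%:E <=
            \int[completion mu]_x min_cost g (raise_price h k (sg / n.+1%:R)) x.
Proof.
move=> sgE; have [_ TE TF] := measure_fiber.
pose cell t := if sg == 1%R then upper_cell g h k t else lower_cell g h k t.
have mcell t : measurable (cell t).
  rewrite /cell; case: ifP => _; first exact: measurable_upper_cell.
  exact: measurable_lower_cell.
have raise_ge n x : min_cost g h x - (sg / n.+1%:R)%:E * (\1_(cell n.+1%:R^-1) x)%:E <=
    min_cost g (raise_price h k (sg / n.+1%:R)) x.
  have inv0 : (0 <= n.+1%:R^-1 :> R)%R by rewrite invr_ge0.
  rewrite -EFinM /cell; case: sgE => ->.
    by rewrite eqxx mul1r; exact: min_cost_raise_price_ge.
  rewrite lt_eqF ?ltrN10// mulN1r mulNr EFinN oppeK; exact: min_cost_lower_price_ge.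
exists (fun n => fine (mu (cell (n.+1%:R^-1)%R))) => [|n].
  rewrite /cell; case: sgE => sgE.
    by rewrite sgE eqxx TE; exact: upper_cells_cvg.
  by rewrite sgE lt_eqF ?ltrN10// TF; exact: lower_cells_cvg.
have mcell' : measurable (cell (n.+1%:R^-1)%R : set (completed mu)).
  exact: measurable_completed.
have int_ind := @integrable_indic_of_finite _ _ _ nu nu_fin _ mcell'.
rewrite EFinM fineK ?fin// -completionE//.
rewrite (_ : completion mu (cell _) =
    \int[completion mu]_x (\1_(cell (n.+1%:R^-1)%R) x)%:E); last first.
  by rewrite integral_indic// setIT.
rewrite -integralZl// -integralB//; last exact: integrableZl.
by apply: le_integral => //; apply: integrableB => //; exact: integrableZl.
Qed.

End cells_limit.

(** * Measurability and integrability along a selection *)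

Section selection.
Context d (Y : measurableType d) (R : realType) (I : finType).
Variables (mu : {measure set Y -> \bar R}) (g : Y -> I -> \bar R) (T : Y -> I).
Local Open Scope ereal_scope.
Hypotheses (mg : forall i, measurable_fun setT (g^~ i))
  (mT : forall i, measurable (T @^-1` [set i] : set (completed mu))).

Lemma measurable_selection :
  measurable_fun setT (fun x : completed mu => g x (T x)).
Proof.
move=> _ B mB; rewrite setTI.
rewrite (_ : _ @^-1` _ = \big[setU/set0]_(i : I)
    ((T @^-1` [set i] : set (completed mu)) `&` (setT `&` (g^~ i) @^-1` B))).
  apply: bigsetU_measurable => i _; apply: measurableI => //.
  by apply: measurable_completed; exact: mg.
rewrite -bigcup_seq; apply/seteqP; split=> x /=.
  by move=> gB; exists (T x) => //=; rewrite mem_index_enum.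
by move=> [i _ [/= <- [_]]].
Qed.

Hypotheses (nu_fin : completion mu setT < +oo).
Let nu : {measure set (completed mu) -> \bar R} := completion mu.

(** The minimal cost lies between a constant and the reduced cost of [T], so one integrable
    selection settles all price vectors at once. *)
Lemma integrable_min_cost (m : R) (h : I -> R) : (forall x i, m%:E <= g x i) ->
  (completion mu).-integrable setT (fun x : completed mu => g x (T x)) ->
  (completion mu).-integrable setT (min_cost g h : completed mu -> _).
Proof.
move=> mleg ig; have [m' mlemin] := min_cost_bounded_below h mleg.
apply: (@integrable_between _ _ _ nu nu_fin m' _
  (fun x : completed mu => g x (T x) - (h (T x))%:E)) => //.
- by apply: measurable_fun_completed; exact: measurable_min_cost.
- by move=> x; exact: min_cost_le.
- by apply: integrableB => //; exact: integrable_comp_finite.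
Qed.

End selection.
Lemma finite_measure_of_fibers d (Y : measurableType d) (R : realType)
    (nu : {measure set Y -> \bar R}) (I : finType) (T : Y -> I) :
  (forall i, measurable (T @^-1` [set i])) ->
  (forall i, nu (T @^-1` [set i]) < +oo)%E -> (nu setT < +oo)%E.
Proof.
move=> mT T_fin.
have -> : setT = \big[setU/set0]_(i : I) (T @^-1` [set i]).
  rewrite -bigcup_seq; apply/esym/seteqP; split=> x // _.
  by exists (T x) => //=; rewrite mem_index_enum.
elim: (index_enum I) => [|i r IH]; first by rewrite big_nil measure0.
rewrite big_cons; apply: le_lt_trans (measureU2 _ _ _) _ => //.
  exact: bigsetU_measurable.
by rewrite lte_add_pinfty // T_fin.
Qed.

Lemma measurable_lsc_section (R : realType) (X : ptopologicalType)
    (D : topologicalType) (f : X * D -> \bar R) (i : D) :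
  lower_semicontinuous f ->
  measurable_fun setT ((fun x => f (x, i)) : borel X -> \bar R).
Proof.
move=> flsc; apply: (measurability _ (ErealGenOInfty.measurableE R)).
move=> /= _ [_ [r ->]] <-; rewrite setTI preimage_itvoy.
apply: sub_sigma_algebra; have : lower_semicontinuous (fun x => f (x, i)).
  (* A product neighbourhood inside [V] has a first factor that serves for the section at [i]. *)
  move=> x s /flsc[V [[P Q] /= [xP iQ] PQV] Vf].
  by exists P => // y Py; apply: Vf; apply: PQV; split=> //=; exact: nbhs_singleton.
by move/lower_semicontinuousP; apply.
Qed.

Lemma ereal_inf_argmin (R : realType) (U : Type) (D : set U) (f : U -> \bar R) (u : U) :
  argmin_on D f u -> ereal_inf [set f t | t in D] = f u.
Proof.
move=> [Du minu]; apply/eqP; rewrite eq_le; apply/andP; split.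
  by apply: ereal_inf_lbound; exists u.
by apply: le_ereal_inf_tmp => _ [t Dt <-]; exact: minu.
Qed.

(** * Lagrangian duality *)

Section network.
Context (R : realType) (V : finType) (A : {set V * V}).
Implicit Types (p : network_arc A -> R) (psi : V -> R).

Definition incidence (k : V) (e : network_arc A) : R :=
  (arc_tail e == k)%:R - (arc_head e == k)%:R.

Lemma net_outflowE p k : net_outflow p k = \sum_e incidence k e * p e.
Proof.
under eq_bigr do rewrite mulrBl.
rewrite sumrB; congr (_ - _); rewrite big_mkcond/=; apply: eq_bigr => e _;
  by case: eqP; rewrite ?mul1r ?mul0r.
Qed.

(** Summation by parts: the incidence matrix is transposed. *)
Lemma sum_net_outflow p psi :
  \sum_k psi k * net_outflow p k =
  \sum_e (psi (arc_tail e) - psi (arc_head e)) * p e.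
Proof.
under eq_bigr do rewrite net_outflowE mulr_sumr.
rewrite exchange_big/=; apply: eq_bigr => e _.
under eq_bigr do rewrite mulrA.
rewrite -mulr_suml; congr (_ * _).
rewrite /incidence; under eq_bigr do rewrite mulrBr.
rewrite sumrB; congr (_ - _).
  rewrite (bigD1 (arc_tail e))//= eqxx mulr1 big1 ?addr0// => k /negbTE.
  by rewrite eq_sym => ->; rewrite mulr0.
rewrite (bigD1 (arc_head e))//= eqxx mulr1 big1 ?addr0// => k /negbTE.
by rewrite eq_sym => ->; rewrite mulr0.
Qed.

(** A price change tilts each arc cost linearly, which is the perturbation treated in
    [argmin_perturb_cvg]. *)
Lemma reduced_arc_cost_raise_price (ca : network_arc A -> R -> \bar R) psi
    (k : V) (t : R) (e : network_arc A) :
  reduced_arc_cost ca (raise_price psi k t) e =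
  (fun x => reduced_arc_cost ca psi e x - ((t * incidence k e) * x)%:E)%E.
Proof.
apply/funext => x; rewrite /reduced_arc_cost /raise_price /incidence.
rewrite -addeA -EFinN -EFinN -EFinN -EFinD; congr (_ + _%:E)%E.
by ring.
Qed.

Lemma sum_endpoint (S : {set V}) (f : V -> R) (w : endpoint S -> R) :
  \sum_k f k * (\sum_(i | endpoint_node i == k) w i) =
  \sum_i f (endpoint_node i) * w i.
Proof.
under eq_bigr do rewrite mulr_sumr.
rewrite (exchange_big_dep xpredT)//=; apply: eq_bigr => i _.
by rewrite (big_pred1 (endpoint_node i))// => k; rewrite eq_sym.
Qed.

End network.
Arguments incidence {R V A} k e.
Section duality.
Context (R : realType) (X : ptopologicalType) (mu : {measure set (borel X) -> \bar R}).
Context (V : finType) (A : {set V * V}) (S : {set V}).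
Variables (s : V -> R) (c : X * endpoint S -> \bar R) (m : R).
Variables (ca : network_arc A -> R -> \bar R) (a b : network_arc A -> R).
Local Open Scope ereal_scope.
Hypotheses (mc : forall i, measurable_fun setT ((fun x => c (x, i)) : borel X -> _))
  (mlec : forall (x : X) i, m%:E <= c (x, i)) (ca_gtNy : forall e t, -oo < ca e t).
Implicit Types (T : X -> endpoint S) (p : network_arc A -> R) (psi : V -> R).

Let g (x : borel X) (i : endpoint S) := c (x, i).
Let price psi (i : endpoint S) := psi (endpoint_node i).
Let nu : {measure set (completed mu) -> \bar R} := completion mu.

Lemma admissible_fiber T p (i : endpoint S) : admissible mu s a b T p ->
  measurable (T @^-1` [set i] : set (completed mu)).
Proof. by case. Qed.

Lemma admissible_fiberE T p (i : endpoint S) : admissible mu s a b T p ->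
  nu (T @^-1` [set i]) = (s (endpoint_node i) - net_outflow p (endpoint_node i))%:E.
Proof.
case=> _ /(_ i) + _ _; rewrite -[completion mu _]/(nu _).
by case: (nu _) => // r [->]; congr EFin; ring.
Qed.

Lemma admissible_finite T p : admissible mu s a b T p -> nu setT < +oo.
Proof.
move=> adm; apply: (@finite_measure_of_fibers _ _ _ nu _ T) => i.
  exact: admissible_fiber adm.
by rewrite (admissible_fiberE _ adm) ltry.
Qed.

(** Neither the integral nor any arc cost can be [-oo], so a total below [+oo] leaves no summand
    infinite. *)
Lemma finite_objective T p : admissible mu s a b T p ->
  objective mu c ca T p < +oo ->
  nu.-integrable setT (fun x => c (x, T x)) /\ forall e, ca e (p e) \is a fin_num.
Proof.
move=> adm; have nu_fin := admissible_finite adm.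
have mcT : measurable_fun setT (fun x : completed mu => c (x, T x)).
  by apply: (@measurable_selection _ _ _ _ mu g) => // i; exact: admissible_fiber adm.
have int_gtNy := @integral_gtNy_of_bounded_below _ _ _ nu nu_fin m _ mcT
  (fun x => mlec x (T x)).
rewrite /objective -[\int[completion mu]_x _]/(\int[nu]_x c (x, T x)).
have sum_neqNy : \sum_e ca e (p e) != -oo.
  rewrite esum_eqNy negb_exists; apply/forallP => e.
  by rewrite gt_eqF ?ca_gtNy// andbF.
move=> obj_lty; split.
  apply: (@integrable_of_bounded_below _ _ _ nu nu_fin m) => //.
  by rewrite ltNge leye_eq; apply: contraTN obj_lty => /eqP ->; rewrite addye// ltxx.
move=> e; rewrite fin_numE gt_eqF ?ca_gtNy//=; apply: contraTN obj_lty => cae.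
have -> : \sum_e ca e (p e) = +oo.
  apply/eqP; rewrite esum_eqy; last by move=> e' _; rewrite gt_eqF ?ca_gtNy.
  by apply/existsP; exists e; rewrite cae.
by rewrite addey ?ltxx// gt_eqF.
Qed.

(** Flow conservation is relaxed with multipliers [psi], and the price terms are regrouped by points
    of [X] and by arcs. *)
Definition lagrangian psi T p : \bar R :=
  \int[completion mu]_x reduced_assignment_cost c psi x (T x)
  + (\sum_i psi i * s i)%:E + \sum_e reduced_arc_cost ca psi e (p e).

(** The prices paid along [T] integrate to the sum of [psi] times supply minus net outflow, which
    cancels the supply term and the price terms of the arcs. *)
Lemma objective_lagrangian psi T p : admissible mu s a b T p ->
  nu.-integrable setT (fun x => c (x, T x)) ->
  (forall e, ca e (p e) \is a fin_num) ->
  objective mu c ca T p = lagrangian psi T p.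
Proof.
move=> adm intc ca_fin; have nu_fin := admissible_finite adm.
have mT i := admissible_fiber i adm.
rewrite /lagrangian /objective -[\int[completion mu]_x c _]/(\int[nu]_x c (x, T x)).
rewrite -[\int[completion mu]_x reduced_assignment_cost _ _ _ _]/(\int[nu]_x
  (c (x, T x) - (price psi (T x))%:E)).
rewrite integralB//; last exact: integrable_comp_finite.
rewrite integral_comp_finite//.
under [X in _ - X]eq_bigr do rewrite (admissible_fiberE _ adm) -EFinM.
rewrite sumEFin /reduced_arc_cost.
have -> : \sum_e (ca e (p e) - ((psi (arc_tail e) - psi (arc_head e)) * p e)%:E) =
    \sum_e ca e (p e) - (\sum_k psi k * net_outflow p k)%:E.
  by rewrite sum_net_outflow -sumEFin -fin_num_sumeN// -big_split.
(* The sum over endpoints extends to all nodes, since off [S] net outflow equals supply. *)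
have -> : (\sum_i price psi i * (s (endpoint_node i) - net_outflow p (endpoint_node i)) =
    \sum_k psi k * s k - \sum_k psi k * net_outflow p k)%R.
  rewrite -sumrB; under [RHS]eq_bigr do rewrite -mulrBr.
  rewrite -(sum_endpoint psi
    (fun i => s (endpoint_node i) - net_outflow p (endpoint_node i)))%R.
  apply: eq_bigr => k _; congr (_ * _)%R; have [kS|kS] := boolP (k \in S).
    pose i : endpoint S := exist _ k kS.
    rewrite (big_pred1 i)// => j; exact/eqP/eqP => [/val_inj|->].
  rewrite big_pred0 => [|i]; first by case: adm => _ _ /(_ k kS) -> _; rewrite subrr.
  by apply: contraNF kS => /eqP <-; exact: valP.
have : \int[nu]_x c (x, T x) \is a fin_num by exact: integrable_fin_num.
have : \sum_e ca e (p e) \is a fin_num by apply/sum_fin_numP => e _ _.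
case: (\sum_e _) => // u _; case: (\int[nu]_x _) => // w _.
by rewrite -!EFinB -!EFinD; congr EFin; ring.
Qed.

Lemma dual_le_lagrangian psi T p : admissible mu s a b T p ->
  nu.-integrable setT (fun x => c (x, T x)) ->
  dual mu s c ca a b psi <= lagrangian psi T p.
Proof.
move=> adm intc; have nu_fin := admissible_finite adm.
have mT i := admissible_fiber i adm.
apply: leeD; first apply: leeD => //.
  apply: (@le_integral _ _ _ nu) => //.
  - exact: (@integrable_min_cost _ _ _ _ mu g T mc mT nu_fin m (price psi) mlec intc).
  - apply: integrableB => //.
    exact: (@integrable_comp_finite _ _ _ nu nu_fin _ T mT (price psi)).
  - by move=> x _; exact: (min_cost_le g (price psi)).
apply: lee_sum => e _; apply: ereal_inf_lbound; exists (p e) => //=.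
by case: adm => _ _ _ /(_ e); rewrite in_itv.
Qed.

Lemma dual_lagrangian psi T p :
  (forall e, argmin_on `[a e, b e] (reduced_arc_cost ca psi e) (p e)) ->
  (forall x, argmin_on [set: endpoint S] (reduced_assignment_cost c psi x) (T x)) ->
  dual mu s c ca a b psi = lagrangian psi T p.
Proof.
move=> pmin Tmin; rewrite /dual /lagrangian; congr (_ + _ + _).
  by apply: eq_integral => x _; exact: (min_cost_argmin (g := g) (h := price psi) (Tmin x)).
by apply: eq_bigr => e _; exact: ereal_inf_argmin.
Qed.

End duality.
(** * First-order condition at a maximizer of the dual *)

(** The first summand of [dual], isolated because the first-order argument uses only a lower bound
    on its change. *)
Definition assignment_value (R : realType) (X : ptopologicalType)
    (mu : {measure set (borel X) -> \bar R}) (V : finType) (S : {set V})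
    (c : X * endpoint S -> \bar R) (psi : V -> R) : \bar R :=
  (\int[completion mu]_x
    \big[Order.min/+oo]_(i : endpoint S) reduced_assignment_cost c psi x i)%E.

Section stationarity.
Context (R : realType) (X : ptopologicalType) (mu : {measure set (borel X) -> \bar R}).
Context (V : finType) (A : {set V * V}) (S : {set V}).
Variables (s : V -> R) (c : X * endpoint S -> \bar R).
Variables (ca : network_arc A -> R -> \bar R) (a b : network_arc A -> R).
Variables (psi : V -> R) (p : network_arc A -> R) (k : V).

Local Notation J := (assignment_value mu c).

Hypotheses (ca_lsc : forall e, lower_semicontinuous (ca e))
  (psi_max : is_maximizer (dual mu s c ca a b) psi)
  (J_fin : J psi \is a fin_num)
  (ca_fin : forall e, ca e (p e) \is a fin_num)
  (pmin : forall e, argmin_on `[a e, b e] (reduced_arc_cost ca psi e) (p e))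
  (puniq : forall e t, argmin_on `[a e, b e] (reduced_arc_cost ca psi e) t -> t = p e).

Lemma lsc_reduced_arc_cost phi e : lower_semicontinuous (reduced_arc_cost ca phi e).
Proof. by apply: lscB_continuous => // x; apply: cvgM; [exact: cvg_cst|exact: cvg_id]. Qed.

(** The three summands of the dual change by at least [- t * w], by exactly [t * s k], and by at
    least the tilt at [q]; maximality of [psi] makes the total nonpositive. *)
Lemma raise_price_inequality (t w : R) (q : network_arc A -> R) :
  (J psi - (t * w)%:E <= J (raise_price psi k t))%E ->
  (forall e, argmin_on `[a e, b e] (reduced_arc_cost ca (raise_price psi k t) e) (q e)) ->
  t * (s k - w - \sum_e incidence k e * q e) <= 0.
Proof.
move=> J_raise qmin.
have red_fin e : reduced_arc_cost ca psi e (p e) \is a fin_num.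
  by rewrite /reduced_arc_cost fin_numB ca_fin.
have := psi_max (raise_price psi k t); rewrite /dual.
rewrite -/(assignment_value mu c _) -/(assignment_value mu c _).
have -> : \sum_i raise_price psi k t i * s i = \sum_i psi i * s i + t * s k.
  rewrite /raise_price; under eq_bigr do rewrite mulrDl.
  rewrite big_split/=; congr (_ + _).
  rewrite (bigD1 k)//= eqxx mulr1 big1 ?addr0// => i /negbTE ->.
  by rewrite mulr0 mul0r.
under [X in (_ <= _ + X)%E]eq_bigr => e _.
  rewrite (ereal_inf_argmin (pmin e)) -(fineK (red_fin e)). over.
(* The perturbed minimizer [q e] competes in the unperturbed arc problem, which is why the bound
   involves [q] and not [p]. *)
have arcs : ((\sum_e fine (reduced_arc_cost ca psi e (p e)))%:E -
     (t * \sum_e incidence k e * q e)%:E <=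
    \sum_e ereal_inf [set reduced_arc_cost ca (raise_price psi k t) e u | u in `[a e, b e]])%E.
  rewrite mulr_sumr -EFinB -sumrB -sumEFin; apply: lee_sum => e _.
  rewrite (ereal_inf_argmin (qmin e)) reduced_arc_cost_raise_price EFinB fineK//.
  rewrite mulrA leeB//; apply: (pmin e).2; exact: (qmin e).1.
move: arcs J_raise J_fin; rewrite sumEFin.
case: (J psi) => // j; set Jr := J _; set ar := (\sum_e ereal_inf _)%E.
move=> le1 le2 _ le3.
have := le_trans (leeD (leeD le2 (lexx _)) le1) le3.
rewrite -!EFinB -!EFinD lee_fin; lra.
Qed.

Lemma net_outflow_stationary (sg W : R) (w : nat -> R) :
  w @ \oo --> W ->
  (forall n, J psi - (sg / n.+1%:R * w n)%:E <=
             J (raise_price psi k (sg / n.+1%:R)))%E ->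
  sg * (s k - W - net_outflow p k) <= 0.
Proof.
move=> wW J_raise; pose t n : R := sg / n.+1%:R.
have t0 : t @ \oo --> 0.
  by rewrite -[0](mulr0 sg); apply: cvgM; [exact: cvg_cst|exact: (@cvg_harmonic R)].
have /choice[q qmin] (ne : nat * network_arc A) : exists u,
    argmin_on `[a ne.2, b ne.2] (reduced_arc_cost ca (raise_price psi k (t ne.1)) ne.2) u.
  apply: lsc_argmin_exists; [exact: lsc_reduced_arc_cost|exact: segment_compact|].
  by exists (p ne.2); exact: (pmin ne.2).1.
have qp e : (fun n => q (n, e)) @ \oo --> p e.
  apply: (@argmin_perturb_cvg _ (reduced_arc_cost ca psi e) (a e) (b e) _
    (fun n => t n * incidence k e)) => //.
  - exact: lsc_reduced_arc_cost.
  - by rewrite /reduced_arc_cost fin_numB ca_fin.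
  - exact: puniq.
  - by rewrite -[0](mul0r (incidence k e)); apply: cvgM => //; exact: cvg_cst.
  - by move=> n; rewrite -reduced_arc_cost_raise_price; exact: (qmin (n, e)).
have lim : (fun n => sg * (s k - w n - \sum_e incidence k e * q (n, e))) @ \oo -->
    sg * (s k - W - net_outflow p k).
  apply: cvgM; first exact: cvg_cst.
  apply: cvgB; first by apply: cvgB => //; exact: cvg_cst.
  rewrite net_outflowE; apply: cvg_big => [|e _]; first exact: add_continuous.
  by apply: cvgM; [exact: cvg_cst|exact: qp].
apply: (cvgr_to_le lim); apply: nearW => n.
have := raise_price_inequality (J_raise n) (fun e => qmin (n, e)).
(* Dividing by the positive factor [1/(n+1)] leaves only the sign [sg]. *)
by rewrite -/(t n) /t mulrAC pmulr_lle0 ?invr_gt0.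
Qed.

End stationarity.

(** * Optimality of the reduced cost minimizers *)

Theorem proposition1
  (R : realType) (X : ptopologicalType)
  (mu : {measure set (borel X) -> \bar R})
  (N : {fset nat}) (A : {set N * N}) (S : {set N})
  (s : N -> R) (c : X * endpoint S -> \bar R)
  (ca : network_arc A -> R -> \bar R) (a b : network_arc A -> R)
  (X_hausdorff : hausdorff_space X)
  (mu_radon : radon mu)
  (ca_gtNy : forall e t, (-oo < ca e t)%E)
  (c_lsc : lower_semicontinuous c)
  (c_bounded_below : exists m : R, forall z, (m%:E <= c z)%E)
  (X_compact : compact [set: X])
  (ca_convex : forall e, convex_ereal (ca e))
  (ca_lsc : forall e, lower_semicontinuous (ca e))
  (M_feasible : exists T p, feasible mu s c ca a b T p)
  (ties_null : forall (i j : endpoint S) (r : R), i != j ->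
    completion mu [set x | [/\ c (x, i) \is a fin_num,
      c (x, j) \is a fin_num & (c (x, i) - c (x, j))%E = r%:E]] = 0%E)
  (dual_attained : exists psi, is_maximizer (dual mu s c ca a b) psi)
  (ca_strictly_convex : forall e, strictly_convex_ereal (ca e))
  (psi : N -> R)
  (psi_max : is_maximizer (dual mu s c ca a b) psi) :
  (forall e, exists! t, argmin_on `[a e, b e] (reduced_arc_cost ca psi e) t) /\
  (forall (T : X -> endpoint S) (p : network_arc A -> R),
    (forall e, argmin_on `[a e, b e] (reduced_arc_cost ca psi e) (p e)) ->
    (forall x, argmin_on [set: endpoint S]
                 (reduced_assignment_cost c psi x) (T x)) ->
    optimal mu s c ca a b T p).
Proof.
have [m mlec] := c_bounded_below.
have [T0 [p0 [adm0 obj0_fin]]] := M_feasible.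
have mc (i : endpoint S) := measurable_lsc_section i c_lsc.
have mlec' (x : X) (i : endpoint S) : (m%:E <= c (x, i))%E := mlec (x, i).
have obj0_lty : (objective mu c ca T0 p0 < +oo)%E by rewrite ltey_eq obj0_fin.
have [ic0 ca0_fin] := finite_objective mc mlec' ca_gtNy adm0 obj0_lty.
have nu_fin := admissible_finite adm0.
have p0ab e : `[a e, b e]%classic (p0 e).
  by case: adm0 => _ _ _ /(_ e); rewrite /= in_itv.
(* The feasible flow [p0] has finite reduced cost on each arc, so the minimum is finite. *)
have argmin_fin e t : argmin_on `[a e, b e] (reduced_arc_cost ca psi e) t ->
    ca e t \is a fin_num.
  case=> _ /(_ _ (p0ab e)); move: (ca0_fin e) (ca_gtNy e t).
  by rewrite /reduced_arc_cost; case: (ca e (p0 e)) => // r _; case: (ca e t).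
have uniq e t t' : argmin_on `[a e, b e] (reduced_arc_cost ca psi e) t ->
    argmin_on `[a e, b e] (reduced_arc_cost ca psi e) t' -> t' = t.
  move=> tmin; have t_fin := argmin_fin e t tmin.
  apply: strictly_convex_argmin_unique tmin.
    exact: (@strictly_convexB_linear _ _ (psi (arc_tail e) - psi (arc_head e))
      (ca_strictly_convex e)).
  by rewrite /reduced_arc_cost fin_numB t_fin.
split=> [e|T p pmin Tmin].
  have [t tmin] : exists t, argmin_on `[a e, b e] (reduced_arc_cost ca psi e) t.
    apply: lsc_argmin_exists; [exact: lsc_reduced_arc_cost|exact: segment_compact|].
    by exists (p0 e).
  by exists t; split=> // t' t'min; apply/esym/(uniq e).
have ca_fin e := argmin_fin e (p e) (pmin e).
pose nu : {measure set (completed mu) -> \bar R} := completion mu.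
pose g (x : borel X) (i : endpoint S) := c (x, i).
pose price phi (i : endpoint S) : R := phi (endpoint_node i).
(* Integrability comes from the feasible [T0], as [T] is not yet known to be measurable. *)
have int_min h : (completion mu).-integrable setT (min_cost g h : completed mu -> _).
  apply: (@integrable_min_cost _ _ _ _ mu g T0 mc _ nu_fin m h) => // i.
  exact: admissible_fiber adm0.
have J_fin := integrable_fin_num measurableT (int_min (price psi)).
have mT i : measurable (T @^-1` [set i] : set (completed mu)).
  by have [] := @measure_fiber _ _ _ _ mu g (price psi) m T i mc mlec'
    ties_null int_min Tmin.
(* Lower bounds for both signs of the price change give two opposite inequalities, hence
   conservation at [k]. *)
have stat k W : (forall sg : R, sg = 1 \/ sg = -1 -> exists2 w : nat -> R, w @ \oo --> W &
    forall n, (\int[completion mu]_x min_cost g (price psi) x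
       - (sg / n.+1%:R * w n)%:E <=
      \int[completion mu]_x min_cost g (price (raise_price psi k (sg / n.+1%:R))) x)%E) ->
    net_outflow p k = s k - W.
  move=> exw; have bound sg : sg = 1 \/ sg = -1 -> sg * (s k - W - net_outflow p k) <= 0.
    move=> /exw[w wW J_raise].
    apply: (@net_outflow_stationary _ _ mu _ _ _ s c ca a b psi p k ca_lsc psi_max
      J_fin ca_fin pmin _ sg W w wW J_raise).
    by move=> e t; exact: uniq.
  have := bound 1 (or_introl erefl); have := bound (-1) (or_intror erefl); lra.
have adm : admissible mu s a b T p.
  split.
  - move=> B; rewrite (_ : _ @^-1` _ = \big[setU/set0]_(i | i \in B) (T @^-1` [set i])).
      exact: bigsetU_measurable.
    rewrite -bigcup_seq_cond; apply/seteqP; split=> x /=.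
      by move=> TB; exists (T x) => //=; rewrite mem_index_enum; exact: mem_set.
    by move=> [i /= /andP[_ iB] ->]; exact: set_mem.
  - move=> i; have fib_fin : completion mu (T @^-1` [set i]) \is a fin_num.
      exact: (@fin_num_of_finite _ _ _ nu nu_fin _ (mT i)).
    rewrite -(fineK fib_fin) -EFinB; congr EFin; apply: stat => sg sgE.
    have [w wW w_bound] := @integral_min_cost_raise_price _ _ _ _ mu g (price psi)
      m T i nu_fin mc mlec' ties_null int_min Tmin sg sgE.
    (* Endpoints are compared through their nodes, so raising the node price restricts by conversion
       to raising the endpoint price. *)
    by exists w.
  (* The price of a node outside [S] does not enter the assignment cost, so [w = 0] works. *)
  - move=> k kS; rewrite -[RHS]subr0; apply: stat => sg _; exists (fun=> 0).
      exact: cvg_cst.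
    move=> n; rewrite mulr0 sube0.
    have -> // : price (raise_price psi k (sg / n.+1%:R)) = price psi.
    apply/funext => j; rewrite /price /raise_price.
    have /negbTE -> : endpoint_node j != k.
      by apply: contraNneq kS => <-; exact: valP.
    by rewrite mulr0 addr0.
  - by move=> e; have [+ _] := pmin e; rewrite /= in_itv.
have intc : (completion mu).-integrable setT (fun x : completed mu => c (x, T x)).
  apply: (eq_integrable _ (fun x : completed mu =>
    min_cost g (price psi) x + (price psi (T x))%:E)%E) => //.
    move=> x _; rewrite (min_cost_argmin (g := g) (h := price psi) (Tmin x)).
    by rewrite subeK.
  by apply: integrableD => //; exact: (@integrable_comp_finite _ _ _ nu nu_fin _ T mT).
have objE := objective_lagrangian psi adm intc ca_fin.
split=> [|T' p' adm'].
  split=> //.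
  rewrite /objective fin_numD integrable_fin_num//=; apply/sum_fin_numP => e _ _.
  exact: ca_fin.
have [obj'_lty|] := ltP (objective mu c ca T' p') +oo%E; last exact: le_trans (leey _).
have [ic' ca'_fin] := finite_objective mc mlec' ca_gtNy adm' obj'_lty.
(* The objective of [(T, p)] is its Lagrangian, hence the dual value at [psi], which bounds the
   Lagrangian of [(T', p')] from below. *)
rewrite objE (objective_lagrangian psi adm' ic' ca'_fin) -(dual_lagrangian mu s pmin Tmin).
exact: (dual_le_lagrangian _ mc mlec' psi adm' ic').
Qed.
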